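(* Let $A_1,A_2\in\mathbb{R}^{m\times n}$ and let $A_1=U_1-V_1$ and $A_2=U_2-V_2$ be two proper weak regular splittings of different types (one of type I and the other of type II). Suppose that $\rho(U_1^{\dagger}V_1)>0$ and $\rho(U_2^{\dagger}V_2)>0$. Assume that $V_1\neq 0$, $V_2\neq 0$ and $A_2^{\dagger}>A_1^{\dagger}\geq 0$. If $V_1\leq V_2$, then $\rho(U_1^{\dagger}V_1)<\rho(U_2^{\dagger}V_2)<1$.
   Context: $A^{\dagger}$ denotes the Moore–Penrose inverse and $\rho(\cdot)$ the spectral radius. Inequalities between matrices are entrywise; $X>Y$ means every entry of $X-Y$ is positive. A splitting $A=U-V$ is proper if $R(U)=R(A)$ and $N(U)=N(A)$. A proper splitting is a proper weak regular splitting of type I if $U^{\dagger}\geq 0$ and $U^{\dagger}V\geq 0$, and of type II if $U^{\dagger}\geq 0$ and $VU^{\dagger}\geq 0$. *)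

(* Defs.v *)
From HB Require Import structures.
From mathcomp Require Import all_boot all_order all_algebra.
From mathcomp Require Import complex.
From mathcomp Require Import classical_sets reals.
Set Implicit Arguments. Unset Strict Implicit. Unset Printing Implicit Defensive.
Import Order.TTheory GRing.Theory Num.Theory.
Local Open Scope ring_scope.

Section Defs.
Variable R : realType.

Definition mx_le m n (X Y : 'M[R]_(m, n)) : Prop := forall i j, X i j <= Y i j.
Definition mx_lt m n (X Y : 'M[R]_(m, n)) : Prop := forall i j, X i j < Y i j.

Definition is_MP_inverse m n (A : 'M[R]_(m, n)) (X : 'M[R]_(n, m)) : Prop :=
  [/\ A *m X *m A = A, X *m A *m X = X,
      (A *m X)^T = A *m X & (X *m A)^T = X *m A].

Definition range_eq m n (X Y : 'M[R]_(m, n)) : Prop :=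
  forall y : 'cV[R]_m, (exists x, y = X *m x) <-> (exists x, y = Y *m x).
Definition null_eq m n (X Y : 'M[R]_(m, n)) : Prop :=
  forall x : 'cV[R]_n, X *m x = 0 <-> Y *m x = 0.

Definition proper_splitting m n (A U V : 'M[R]_(m, n)) : Prop :=
  [/\ A = U - V, range_eq U A & null_eq U A].

Definition pwrs_typeI m n (A U V : 'M[R]_(m, n)) (Ud : 'M[R]_(n, m)) : Prop :=
  [/\ proper_splitting A U V, is_MP_inverse U Ud,
      mx_le 0 Ud & mx_le 0 (Ud *m V)].
Definition pwrs_typeII m n (A U V : 'M[R]_(m, n)) (Ud : 'M[R]_(n, m)) : Prop :=
  [/\ proper_splitting A U V, is_MP_inverse U Ud,
      mx_le 0 Ud & mx_le 0 (V *m Ud)].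

Definition spectral_radius n (M : 'M[R]_n) : R :=
  sup [set r : R | exists l : R[i],
         eigenvalue (map_mx (fun x : R => (x%:C)%C) M) l /\ r = Normc.normc l].

End Defs.

(* Main.v *)
(** For P = U^+ and X = A^+, a proper splitting A = U - V gives
    X = P + P V X = P + X V P, so 1 + X V and 1 + V X are the inverses of
    1 - P V and 1 - V P.  Suppose T = P1 V1 and S = V2 P2 are nonnegative, and
    let r be the spectral radius of T.  The moduli of the entries of an
    eigenvector give a row x >= 0 with r x <= x T; hence z = x X1 satisfies
    r x <= (1 - r) z V1, and X1 < X2 with V1 <= V2 gives the strict inequality
    r z < (1 - r) z V2 X2.  If no eigenvalue of S exceeded r in modulus, the
    resolvent of S would be nonnegative to the right of r, which contradicts
    this inequality.  The other assignment of types follows by transposition. *)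

Require Import Defs.
From HB Require Import structures.
From mathcomp Require Import all_boot all_order all_algebra.
From mathcomp Require Import complex.
From mathcomp Require Import classical_sets reals.
From mathcomp Require Import lra.
Import Order.TTheory GRing.Theory Num.Theory.
Local Open Scope ring_scope.

Set Implicit Arguments. Unset Strict Implicit.

(** * Entrywise order on real matrices *)

Section EntrywiseOrder.
Variable R : realType.

Lemma mx_le_trans m n (A B C : 'M[R]_(m, n)) :
  mx_le A B -> mx_le B C -> mx_le A C.
Proof. by move=> AB BC i j; apply: le_trans (AB i j) (BC i j). Qed.

Lemma mx_le_subr m n (A B : 'M[R]_(m, n)) : mx_le 0 (B - A) <-> mx_le A B.
Proof. by split=> AB i j; move: (AB i j); rewrite !mxE subr_ge0. Qed.

Lemma mx_ge0_entry m n (A : 'M[R]_(m, n)) i j : mx_le 0 A -> 0 <= A i j.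
Proof. by move/(_ i j); rewrite mxE. Qed.

Lemma mulmx_ge0 m n p (A : 'M[R]_(m, n)) (B : 'M[R]_(n, p)) :
  mx_le 0 A -> mx_le 0 B -> mx_le 0 (A *m B).
Proof.
move=> A0 B0 i j; rewrite !mxE sumr_ge0// => k _.
by rewrite mulr_ge0 ?mx_ge0_entry.
Qed.

Lemma mx_le_mull m n p (A B : 'M[R]_(n, p)) (C : 'M[R]_(m, n)) :
  mx_le 0 C -> mx_le A B -> mx_le (C *m A) (C *m B).
Proof.
by move=> C0 /mx_le_subr AB; apply/mx_le_subr; rewrite -mulmxBr; apply: mulmx_ge0.
Qed.

Lemma mx_le_mulr m n p (A B : 'M[R]_(m, n)) (C : 'M[R]_(n, p)) :
  mx_le 0 C -> mx_le A B -> mx_le (A *m C) (B *m C).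
Proof.
by move=> C0 /mx_le_subr AB; apply/mx_le_subr; rewrite -mulmxBl; apply: mulmx_ge0.
Qed.

Lemma mx_le_tr m n (A B : 'M[R]_(m, n)) : mx_le A B -> mx_le A^T B^T.
Proof. by move=> AB i j; rewrite !mxE. Qed.

Lemma mx_ge0_tr m n (A : 'M[R]_(m, n)) : mx_le 0 A -> mx_le 0 A^T.
Proof. by move/mx_le_tr; rewrite trmx0. Qed.

Lemma mx_le_anti m n (A B : 'M[R]_(m, n)) : mx_le A B -> mx_le B A -> A = B.
Proof.
by move=> AB BA; apply/matrixP => i j; apply/eqP; rewrite eq_le AB BA.
Qed.

Lemma mx_lt_mull_row m n (x : 'rV[R]_m) (A B : 'M[R]_(m, n)) :
  mx_le 0 x -> x != 0 -> mx_lt A B -> mx_lt (x *m A) (x *m B).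
Proof.
move=> x0 xN0 AB i j; rewrite ord1 !mxE.
have [k xk] : exists k, 0 < x 0 k.
  have /rV0Pn[k xk] := xN0; exists k.
  by rewrite lt_neqAle eq_sym xk mx_ge0_entry.
rewrite (bigD1 k)//= [ltRHS](bigD1 k)//= ltr_leD ?ltr_pM2l ?AB//.
apply: ler_sum => l _; apply: ler_wpM2l; last exact/ltW/AB.
exact: mx_ge0_entry.
Qed.

(** Turns finitely many strict inequalities into one uniform margin. The constant [c] exceeds every
    [|w i| / u i], so its inverse serves as [d]. *)
Lemma exists_small_scalar (I : finType) (u w : I -> R) :
  (forall i, 0 < u i) -> exists2 d, 0 < d & forall i, d * w i < u i.
Proof.
move=> u0; pose c := 1 + \sum_i `|w i| / u i.
have S0 (P : pred I) : 0 <= \sum_(i | P i) `|w i| / u i.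
  by apply: sumr_ge0 => i _; rewrite divr_ge0// ltW.
have c0 : 0 < c by rewrite ltr_pwDl.
exists c^-1 => [|i]; first by rewrite invr_gt0.
rewrite mulrC ltr_pdivrMr// (le_lt_trans (ler_norm _))//.
rewrite mulrC -ltr_pdivrMr// /c (bigD1 i)//=.
by move: (S0 (fun j => j != i)); lra.
Qed.

End EntrywiseOrder.

(** * Nonnegativity of the resolvent of a nonnegative matrix *)

Section Resolvent.
Variable R : realType.

(* Minimum principle: subtract from x the multiple of v which touches it from
   below, and look at the entry where they touch. *)
Lemma monotone_of_dominated n (M : 'M[R]_n) (t : R) (v x : 'rV[R]_n) :
  mx_le 0 M -> mx_lt 0 v -> mx_lt (v *m M) (t *: v) ->
  mx_le (x *m M) (t *: x) -> mx_le 0 x.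
Proof.
move=> M0 v0 vM xM i0 k; rewrite ord1 mxE leNgt; apply/negP => xk {i0}.
have {}v0 j : 0 < v 0 j by move: (v0 0 j); rewrite mxE.
have [i _ imin] := @Order.TotalTheory.arg_minP _ _ _ k xpredT
  (fun j => x 0 j / v 0 j) isT.
set c := x 0 i / v 0 i in imin.
have c0 : c < 0.
  by apply: le_lt_trans (imin k isT) _; rewrite pmulr_llt0 ?invr_gt0.
have xi : x 0 i = c * v 0 i by rewrite /c divfK// gt_eqF.
have y0 : mx_le 0 (x - c *: v).
  by move=> a j; rewrite ord1 !mxE subr_ge0 -ler_pdivlMr// imin.
have subZE (a b : 'rV[R]_n) : (a - c *: b) 0 i = a 0 i - c * b 0 i.
  by rewrite !mxE.
have ZE (a : 'rV[R]_n) : (t *: a) 0 i = t * a 0 i by rewrite mxE.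
have := mx_ge0_entry 0 i (mulmx_ge0 y0 M0).
rewrite mulmxBl -scalemxAl subZE; move: (vM 0 i) (xM 0 i).
rewrite !ZE xi => vMi xMi; rewrite leNgt => /negP; apply.
rewrite subr_lt0; apply: le_lt_trans xMi _.
by rewrite mulrCA ltr_nM2l.
Qed.

(* G is the set of t >= s for which M is strictly dominated by t on some
   positive row; its infimum belongs to G because it is not an eigenvalue, and
   equals s because strict domination is an open condition. *)
Lemma resolvent_ge0 n (M : 'M[R]_n) (s : R) :
  mx_le 0 M -> 0 < s -> (forall t, s <= t -> t%:M - M \in unitmx) ->
  mx_le 0 (invmx (s%:M - M)).
Proof.
move=> M0 s0 unitM.
pose G := [set t | s <= t /\ exists2 v : 'rV[R]_n,
  mx_lt 0 v & mx_lt (v *m M) (t *: v)]%classic.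
have G0 : (G !=set0)%classic.
  (* On the all-ones row, any [t] above all column sums of [M] dominates. *)
  pose e : 'rV[R]_n := const_mx 1.
  have [d d0 dM] := @exists_small_scalar R _ (fun=> 1) (fun j => (e *m M) 0 j)
    (fun=> ltr01).
  exists (s + d^-1); split; first by rewrite lerDl invr_ge0 ltW.
  exists e => i j; first by rewrite !mxE.
  rewrite ord1 [ltRHS]mxE [e 0 j]mxE mulr1.
  have := dM j; rewrite mulrC -ltr_pdivlMr// div1r => /lt_le_trans; apply.
  by rewrite lerDr ltW.
have lbG : lbound G s by move=> t [].
have up t : inf G < t -> exists2 v : 'rV[R]_n,
    mx_lt 0 v & mx_lt (v *m M) (t *: v).
  move=> /(inf_lt G0)[y [_ [v v0 vM]] yt]; exists v => // i j.
  apply: lt_le_trans (vM i j) _; rewrite !mxE ler_wpM2r ?ltW//.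
  by move: (v0 i j); rewrite mxE.
set t := inf G in up; have st : s <= t by apply: lb_le_inf.
have tN0 : 0 < t by apply: lt_le_trans st.
(* As [v] solves [v (t - M) = 1], the row [v M] lies below [t v] by exactly 1 in each entry. *)
pose v : 'rV[R]_n := const_mx 1 *m invmx (t%:M - M).
have vE j : (v *m M) 0 j = t * v 0 j - 1.
  have : v *m (t%:M - M) = const_mx 1 by rewrite mulmxKV ?unitM.
  rewrite mulmxBr mul_mx_scalar => /rowP/(_ j).
  by rewrite mxE [(t *: v) 0 j]mxE [(- (v *m M)) 0 j]mxE [const_mx _ 0 j]mxE; lra.
have v_ge0 : mx_le 0 v.
  (* A dominated row is so far known only above the infimum, so the minimum principle is used at
     [t + d], with [d] small enough that [v M <= (t + d) v]. *)
  have [d d0 dv] := @exists_small_scalar R _ (fun=> 1) (fun j => - v 0 j)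
    (fun=> ltr01).
  have [|w w0 wM] := up (t + d); first by rewrite ltrDl.
  apply: (monotone_of_dominated (t := t + d) (v := w)) => // i j.
  by rewrite ord1 vE [leRHS]mxE; move: (dv j); lra.
have v_gt0 j : 0 < v 0 j.
  rewrite -(pmulr_rgt0 _ tN0); move: (vE j).
  have := mx_ge0_entry 0 j (mulmx_ge0 v_ge0 M0); lra.
have ts : t = s.
  apply/eqP; rewrite eq_le st andbT leNgt; apply/negP => lt_st.
  have [d d0 dv] := @exists_small_scalar R _ (fun=> 1) (fun j => v 0 j)
    (fun=> ltr01).
  (* This [e] keeps [t - e >= s] and [e v < 1] entrywise, so [v] puts [t - e] in [G], below its
     infimum. *)
  pose e := Num.min d (t - s).
  have e0 : 0 < e by rewrite lt_min d0 subr_gt0.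
  have : t <= t - e.
    apply: ge_inf; first by exists s.
    have e_ts : e <= t - s by rewrite ge_min lexx orbT.
    split; first by lra.
    exists v => i j; rewrite ord1; first by rewrite mxE.
    rewrite vE [ltRHS]mxE.
    have e_d : e <= d by rewrite ge_min lexx.
    have := ler_wpM2r (ltW (v_gt0 j)) e_d.
    by move: (dv j); lra.
  lra.
move=> i j.
suff /(_ 0 j) : mx_le 0 (row i (invmx (s%:M - M))) by rewrite !mxE.
apply: (monotone_of_dominated (t := s) (v := v)) => // [a k|a k|a k].
- by rewrite ord1 mxE.
- by rewrite ord1 vE ts [ltRHS]mxE; lra.
rewrite ord1; set x := row _ _.
have : x *m (s%:M - M) = row i 1%:M by rewrite -row_mul mulVmx ?unitM.
rewrite mulmxBr mul_mx_scalar => /rowP/(_ k).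
rewrite mxE [(- (x *m M)) 0 k]mxE [row i 1%:M 0 k]mxE => xE.
by rewrite -subr_ge0 xE mxE ler0n.
Qed.

End Resolvent.

(** * Spectral radius, eigenvalues and subeigenvectors *)

Section SpectralRadius.
Variable R : realType.

Let toC n (M : 'M[R]_n) : 'M[R[i]]_n := map_mx (fun x : R => (x%:C)%C) M.

(** The supremum runs over the finitely many roots of the characteristic polynomial. With no
    eigenvalue it is [sup set0 = 0], hence the positivity guard on attainment. *)
Lemma spectral_radiusP n (M : 'M[R]_n) :
  [/\ 0 <= spectral_radius M,
      forall l, eigenvalue (toC M) l -> Normc.normc l <= spectral_radius M &
      0 < spectral_radius M ->
      exists2 l, eigenvalue (toC M) l & Normc.normc l = spectral_radius M].
Proof.
set E := [set r : R | exists l : R[i],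
         eigenvalue (toC M) l /\ r = Normc.normc l]%classic.
have rhoE : spectral_radius M = sup E by [].
have nc0 (z : R[i]) : 0 <= Normc.normc z by case: z => a b; apply: sqrtr_ge0.
have [E0|/set0P EN0] := eqVneq E set0.
  rewrite rhoE E0 sup0; split; rewrite ?ltxx// => l el.
  have : E (Normc.normc l) by exists l.
  by rewrite E0.
have [rs rsE] := closed_field_poly_normal (char_poly (toC M)).
have eigE l : eigenvalue (toC M) l = (l \in rs).
  rewrite eigenvalue_root_char rsE rootZ ?root_prod_XsubC//.
  by rewrite lead_coef_eq0 monic_neq0 ?char_poly_monic.
have [l0 l0rs l0max] : exists2 l0, l0 \in rs &
    forall l, l \in rs -> Normc.normc l <= Normc.normc l0.
  have : rs != [::].
    by have [r [l [+ _]]] := EN0; rewrite eigE; case: (rs).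
  elim: (rs) => [|a [|b r] IHr _]; first by rewrite eqxx.
    by exists a => [|l]; rewrite inE// => /eqP ->.
  have [//|l lr lmax] := IHr.
  have [al|la] := leP (Normc.normc a) (Normc.normc l).
    exists l => [|k]; first by rewrite inE lr orbT.
    by rewrite inE => /predU1P[->//|/lmax].
  exists a => [|k]; first by rewrite inE eqxx.
  by rewrite inE => /predU1P[->//|/lmax/le_trans]; apply; apply: ltW.
have ubE : ubound E (Normc.normc l0) by move=> _ [l [+ ->]]; rewrite eigE => /l0max.
have rho0 : sup E = Normc.normc l0.
  apply/eqP; rewrite eq_le ge_sup//= ub_le_sup//; first by exists (Normc.normc l0).
  by exists l0; rewrite eigE.
rewrite rhoE rho0; split=> // [l|_]; first by rewrite eigE => /l0max.
by exists l0; rewrite ?eigE.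
Qed.

Lemma spectral_radius_ge0 n (M : 'M[R]_n) : 0 <= spectral_radius M.
Proof. by have [] := spectral_radiusP M. Qed.

(** An eigenvector [v] of [A B] yields [v A] for [B A]; it is nonzero because [v A B = l v] is. *)
Lemma eigenvalue_mulmxC (F : fieldType) m n (A : 'M[F]_(m, n))
    (B : 'M[F]_(n, m)) l :
  l != 0 -> eigenvalue (A *m B) l -> eigenvalue (B *m A) l.
Proof.
move=> l0 /eigenvalueP[v vE vN0]; apply/eigenvalueP; exists (v *m A).
  by rewrite mulmxA -(mulmxA v) vE scalemxAl.
apply: contra vN0 => /eqP vA0; move: vE; rewrite mulmxA vA0 mul0mx => /esym/eqP.
by rewrite scalemx_eq0 (negPf l0).
Qed.

Lemma eigenvalue_trmx (F : fieldType) n (A : 'M[F]_n) l :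
  eigenvalue A^T l = eigenvalue A l.
Proof.
rewrite !eigenvalue_root_char /char_poly -[in RHS]det_tr; congr (root (\det _) _).
by rewrite /char_poly_mx linearB /= tr_scalar_mx map_trmx.
Qed.

Lemma spectral_radius_le m n (A : 'M[R]_m) (B : 'M[R]_n) :
  (forall l, l != 0 -> eigenvalue (toC A) l -> eigenvalue (toC B) l) ->
  spectral_radius A <= spectral_radius B.
Proof.
move=> AB; have [r0 _ att] := spectral_radiusP A.
move: r0; rewrite le_eqVlt => /predU1P[<-|r0]; first exact: spectral_radius_ge0.
have [l el lE] := att r0; have [_ ub _] := spectral_radiusP B.
rewrite -lE; apply/ub/AB => //.
by apply: contraTneq r0 => l0; rewrite -lE l0 Normc.normc0 ltxx.
Qed.

Lemma spectral_radius_tr n (M : 'M[R]_n) :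
  spectral_radius M^T = spectral_radius M.
Proof.
have eig_tr l : eigenvalue (toC M^T) l = eigenvalue (toC M) l.
  by rewrite /toC -map_trmx eigenvalue_trmx.
apply/eqP; rewrite eq_le; apply/andP.
by split; apply: spectral_radius_le => l _; rewrite (eig_tr l).
Qed.

Lemma spectral_radius_mulmxC m n (A : 'M[R]_(m, n)) (B : 'M[R]_(n, m)) :
  spectral_radius (A *m B) = spectral_radius (B *m A).
Proof.
suff le p q (C : 'M[R]_(p, q)) (D : 'M[R]_(q, p)) :
    spectral_radius (C *m D) <= spectral_radius (D *m C).
  by apply/eqP; rewrite eq_le !le.
apply: spectral_radius_le => l l0; rewrite /toC !map_mxM.
exact: eigenvalue_mulmxC.
Qed.

(** Take moduli in [v M = l v] with [|l|] maximal and apply the triangle inequality; the entries of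
    [M] are their own moduli. *)
Lemma subeigenvector n (M : 'M[R]_n) :
  mx_le 0 M -> 0 < spectral_radius M ->
  exists x : 'rV[R]_n, [/\ mx_le 0 x, x != 0 &
    mx_le (spectral_radius M *: x) (x *m M)].
Proof.
move=> M0 rho0; have [_ _ /(_ rho0)[l /eigenvalueP[v vE vN0] <-]] :=
  spectral_radiusP M.
exists (\row_j Normc.normc (v 0 j)); split.
- by move=> i j; rewrite !mxE; case: (v 0 j) => a b; apply: sqrtr_ge0.
- apply: contra vN0 => /eqP/rowP v0; apply/eqP/rowP => j.
  by move: (v0 j); rewrite !mxE => /Normc.eq0_normc.
move=> i j; rewrite 2!mxE -Normc.normcM.
have -> : l * v 0 j = (l *: v) 0 j by rewrite mxE.
rewrite -vE !mxE.
have normc_sum (I : finType) (F : I -> R[i]) :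
    Normc.normc (\sum_k F k) <= \sum_k Normc.normc (F k).
  elim/big_ind2: _ => [|a b c d ab cd|//]; first by rewrite Normc.normc0.
  by apply: le_trans (le_normcD _ _) _; apply: lerD.
apply: le_trans (normc_sum _ _) _; apply: ler_sum => k _.
rewrite !mxE Normc.normcM [X in _ * X]/Normc.normc /= expr0n addr0 sqrtr_sqr.
by rewrite ger0_norm// mx_ge0_entry.
Qed.

Lemma spectral_resolvent n (M : 'M[R]_n) (s : R) :
  mx_le 0 M -> spectral_radius M < s ->
  s%:M - M \in unitmx /\ mx_le 0 (invmx (s%:M - M)).
Proof.
move=> M0 rho_s.
have s0 : 0 < s by apply: le_lt_trans rho_s; apply: spectral_radius_ge0.
have U t : s <= t -> t%:M - M \in unitmx.
  (* A singular [t - M] would make [t] an eigenvalue of modulus beyond the spectral radius. *)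
  move=> st; rewrite unitmxE unitfE; apply/negP => /det0P[v vN0].
  rewrite mulmxBr mul_mx_scalar => /eqP; rewrite subr_eq0 => /eqP vM.
  have et : eigenvalue (toC M) (t%:C)%C.
    by rewrite eigenvalue_map; apply/eigenvalueP; exists v.
  have [_ /(_ _ et) + _] := spectral_radiusP M.
  rewrite /Normc.normc /= expr0n addr0 sqrtr_sqr leNgt => /negP; apply.
  by apply: lt_le_trans rho_s _; apply: le_trans st (ler_norm _).
by split; [apply: U | apply: resolvent_ge0].
Qed.

End SpectralRadius.

(** * Moore-Penrose identities for proper splittings *)

Section ProperSplittings.
Variable R : realType.

Lemma range_eq_factor m n (A B : 'M[R]_(m, n)) :
  range_eq A B -> exists C, A = B *m C.
Proof.
move=> AB.
have /fin_all_exists[f fE] j : exists x, col j A = B *m x.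
  by apply/AB; exists (delta_mx j 0); rewrite colE.
exists (\matrix_(i, j) f j i 0); apply/matrixP => i j.
have /colP/(_ i) := fE j; rewrite !mxE => ->.
by apply: eq_bigr => k _; rewrite mxE.
Qed.

Lemma null_eq_mulmx m n p (A B : 'M[R]_(m, n)) (C : 'M[R]_(n, p)) :
  null_eq A B -> A *m C = 0 -> B *m C = 0.
Proof.
move=> AB AC0; apply/matrixP => i j.
have /AB/colP/(_ i) : A *m col j C = 0 by rewrite colE mulmxA AC0 mul0mx.
by rewrite colE mulmxA -colE !mxE.
Qed.

(** Both sides are orthogonal projections onto the common range: each fixes the range of the other,
    and symmetry allows the factors to be swapped by transposing. *)
Lemma MP_range_projection m n (A U : 'M[R]_(m, n)) (X P : 'M[R]_(n, m)) :
  is_MP_inverse A X -> is_MP_inverse U P -> range_eq U A ->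
  U *m P = A *m X.
Proof.
move=> [AXA _ AXt _] [UPU _ UPt _] UA.
have [C UE] := range_eq_factor UA.
have [|D AE] := @range_eq_factor _ _ A U; first by move=> y; split=> /UA.
have AXU : A *m X *m U = U by rewrite UE mulmxA AXA.
have UPA : U *m P *m A = A by rewrite [in LHS]AE mulmxA UPU -AE.
rewrite -[LHS]UPt -[in LHS]AXU -mulmxA trmx_mul UPt AXt.
by rewrite mulmxA UPA.
Qed.

(** Both sides are the orthogonal projection onto the complement of the common null space. *)
Lemma MP_null_projection m n (A U : 'M[R]_(m, n)) (X P : 'M[R]_(n, m)) :
  is_MP_inverse A X -> is_MP_inverse U P -> null_eq U A ->
  P *m U = X *m A.
Proof.
move=> [AXA _ _ XAt] [UPU _ _ PUt] UA.
have APU : A *m (P *m U) = A.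
  apply/eqP; rewrite -subr_eq0 -[X in _ - X]mulmx1 -mulmxBr; apply/eqP.
  by apply: null_eq_mulmx UA _; rewrite mulmxBr mulmx1 mulmxA UPU subrr.
have UXA : U *m (X *m A) = U.
  apply/eqP; rewrite -subr_eq0 -[X in _ - X]mulmx1 -mulmxBr; apply/eqP.
  have AU : null_eq A U by move=> x; split=> /UA.
  by apply: null_eq_mulmx AU _; rewrite mulmxBr mulmx1 mulmxA AXA subrr.
rewrite -[RHS]XAt -[in RHS]APU mulmxA trmx_mul PUt XAt.
by rewrite -mulmxA UXA.
Qed.

(** With [V = U - A], the equal projections give [P U X = X] and [P A X = P], so [P V X = X - P];
    likewise for [X V P]. *)
Lemma proper_splitting_MP m n (A U V : 'M[R]_(m, n)) (X P : 'M[R]_(n, m)) :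
  is_MP_inverse A X -> is_MP_inverse U P -> proper_splitting A U V ->
  X = P + P *m V *m X /\ X = P + X *m V *m P.
Proof.
move=> mpA mpU [AE rUA nUA].
have UP := MP_range_projection mpA mpU rUA.
have PU := MP_null_projection mpA mpU nUA.
have [_ XAX _ _] := mpA; have [_ PUP _ _] := mpU.
have -> : V = U - A by rewrite AE opprB addrC subrK.
split.
  by rewrite mulmxBr mulmxBl PU XAX -(mulmxA P) -UP mulmxA PUP addrC subrK.
by rewrite mulmxBr mulmxBl -PU PUP -(mulmxA X) UP mulmxA XAX addrC subrK.
Qed.

End ProperSplittings.

(** * Convergence and comparison of the two splittings *)

Section Comparison.
Variable R : realType.

Lemma resolvent_of_splitting m n (V : 'M[R]_(m, n)) (P X : 'M[R]_(n, m)) :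
  X = P + P *m V *m X ->
  (1%:M - P *m V) *m (1%:M + X *m V) = 1%:M.
Proof.
move=> XE; rewrite mulmxBl mul1mx mulmxDr mulmx1 [in X in X - _]XE.
by rewrite mulmxDl mulmxA addrK.
Qed.

(** Otherwise some nonzero [x >= 0] has [x <= x P V]. Multiplying by [X] gives [x X <= x X - x P],
    so [x P = 0] and then [x <= 0]. *)
Lemma spectral_radius_lt1 m n (V : 'M[R]_(m, n)) (P X : 'M[R]_(n, m)) :
  mx_le 0 P -> mx_le 0 X -> mx_le 0 (P *m V) -> X = P + P *m V *m X ->
  spectral_radius (P *m V) < 1.
Proof.
move=> P0 X0 T0 XE; rewrite ltNge; apply/negP => rho1.
have [x [x0 xN0 xT]] := subeigenvector T0 (lt_le_trans ltr01 rho1).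
have {}xT : mx_le x (x *m (P *m V)).
  by apply: mx_le_trans xT => i j; rewrite mxE ler_peMl// mx_ge0_entry.
have xP : x *m P = 0.
  apply: mx_le_anti; last exact: mulmx_ge0.
  apply/mx_le_subr; rewrite sub0r.
  have /mx_le_subr := mx_le_mulr X0 xT.
  by rewrite {2}XE mulmxDr -!mulmxA opprD addrCA subrr addr0.
case/eqP: xN0; apply: (mx_le_anti _ x0).
by move: xT; rewrite mulmxA xP mul0mx.
Qed.

Lemma splitting_comparison m n (V1 V2 : 'M[R]_(m, n))
    (P1 X1 P2 X2 : 'M[R]_(n, m)) :
  mx_le 0 P1 -> mx_le 0 (P1 *m V1) -> X1 = P1 + P1 *m V1 *m X1 ->
  mx_le 0 P2 -> mx_le 0 (V2 *m P2) -> X2 = P2 + X2 *m V2 *m P2 ->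
  mx_le 0 X1 -> mx_lt X1 X2 -> mx_le V1 V2 ->
  0 < spectral_radius (P1 *m V1) ->
  spectral_radius (P1 *m V1) < spectral_radius (V2 *m P2) /\
  spectral_radius (V2 *m P2) < 1.
Proof.
move=> P10 T0 X1E P20 S0 X2E X10 X12 V12 rho0.
have X20 : mx_le 0 X2 by apply: mx_le_trans X10 _ => i j; apply: ltW.
split; last first.
  (* Transposition turns [V2 P2] into the product order of [spectral_radius_lt1]. *)
  rewrite -spectral_radius_tr trmx_mul.
  apply: (@spectral_radius_lt1 _ _ _ _ X2^T); try exact: mx_ge0_tr.
    by rewrite -trmx_mul; apply: mx_ge0_tr.
  by rewrite [in LHS]X2E linearD /= !trmx_mul !mulmxA.
set T := P1 *m V1 in T0 rho0 *; set S := V2 *m P2 in S0 *.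
have rho1 : spectral_radius T < 1 by apply: spectral_radius_lt1 X1E.
have [x [x0 xN0]] := subeigenvector T0 rho0.
set r := spectral_radius T in rho0 rho1 * => xT.
pose z := x *m X1; have z0 : mx_le 0 z by apply: mulmx_ge0.
(* Multiplying [r x <= x T] by the nonnegative inverse [1 + X1 V1] of [1 - T] gives
   [r (x + z V1) <= z V1]. *)
have zV1 : mx_le (r *: x) ((1 - r) *: (z *m V1)).
  have [U1 inv0] := spectral_resolvent T0 rho1.
  have IT : (1%:M - T) *m (1%:M + X1 *m V1) = 1%:M.
    exact: resolvent_of_splitting.
  have invE : invmx (1%:M - T) = 1%:M + X1 *m V1.
    have := congr1 (mulmx (invmx (1%:M - T))) IT.
    by rewrite mulmxA mulVmx// mul1mx mulmx1.
  move/(mx_le_mulr inv0): xT; rewrite invE.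
  have -> : x *m T *m (1%:M + X1 *m V1) = z *m V1.
    rewrite -mulmxA mulmxDr mulmx1 /z -mulmxA; congr (_ *m _).
    by rewrite [in RHS]X1E mulmxDl mulmxA.
  rewrite mulmxDr mulmx1 -scalemxAl mulmxA => le i j; move: (le i j).
  by rewrite !mxE; lra.
have zN0 : z != 0.
  apply: contra xN0 => /eqP zE0; apply/eqP/mx_le_anti => // i j.
  by move: (zV1 i j); rewrite zE0 mul0mx !mxE mulr0 pmulr_rle0.
(* The chain is [r z = r x X1 < r x X2 <= (1 - r) z V1 X2 <= (1 - r) z V2 X2]. *)
have zH : mx_lt (r *: z) ((1 - r) *: (z *m (V2 *m X2))).
  move=> i j.
  have rx0 : mx_le 0 (r *: x).
    by move=> a b; rewrite !mxE mulr_ge0 ?mx_ge0_entry// ltW.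
  have rxN0 : r *: x != 0 by rewrite scalemx_eq0 negb_or gt_eqF.
  have -> : r *: z = (r *: x) *m X1 by rewrite -scalemxAl.
  apply: lt_le_trans (mx_lt_mull_row rx0 rxN0 X12 i j) _.
  apply: le_trans (mx_le_mulr X20 zV1 i j) _.
  rewrite -scalemxAl -mulmxA [leLHS]mxE [leRHS]mxE.
  rewrite ler_wpM2l ?subr_ge0 ?(ltW rho1)//.
  by apply: (mx_le_mull z0); apply: mx_le_mulr.
rewrite ltNge; apply/negP => S_r.
(* With w = z (1 + H) one has w S = z H, and the strict inequality zH becomes
   (r + d) w <= w S; multiplying by the resolvent of S gives w <= 0. *)
set H := V2 *m X2 in zH.
have HE : H = S + H *m S by rewrite {1}/H X2E mulmxDr !mulmxA.
pose w := z *m (1%:M + H).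
have wS : w *m S = z *m H.
  by rewrite /w -mulmxA mulmxDl mul1mx -HE.
have [j|d d0 dw] := @exists_small_scalar R _
    (fun j => ((1 - r) *: (z *m H)) 0 j - (r *: z) 0 j) (fun j => w 0 j).
  by rewrite subr_gt0.
have le_wS : mx_le (w *m ((r + d)%:M - S)) 0.
  move=> i j; rewrite ord1 mulmxBr mul_mx_scalar wS; move: (dw j).
  rewrite /w mulmxDr mulmx1; set y := z *m H; rewrite !mxE; lra.
have [|US Q0] := @spectral_resolvent _ _ _ (r + d) S0; first by lra.
have w0 : mx_le w 0.
  by have := mx_le_mulr Q0 le_wS; rewrite mulmxK// mul0mx.
(* By [zH] and [r < 1] the row [z H] is positive, so [w = z + z H <= 0] forces [z <= 0]. *)
case/eqP: zN0; apply: (mx_le_anti _ z0) => i j.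
move: (w0 i j) (zH i j) (mx_ge0_entry i j z0).
rewrite /w mulmxDr mulmx1; clearbody z; move: (z *m H) => y.
rewrite !mxE => zy rzy z_ge0.
have : 0 < (1 - r) * y i j by apply: le_lt_trans rzy; rewrite mulr_ge0// ltW.
by rewrite pmulr_rgt0 ?subr_gt0//; lra.
Qed.

End Comparison.

Theorem theorem3p14 (R : realType) (m n : nat)
  (A1 A2 U1 V1 U2 V2 : 'M[R]_(m, n))
  (A1d A2d U1d U2d : 'M[R]_(n, m)) :
  is_MP_inverse A1 A1d -> is_MP_inverse A2 A2d ->
  is_MP_inverse U1 U1d -> is_MP_inverse U2 U2d ->
  (pwrs_typeI A1 U1 V1 U1d /\ pwrs_typeII A2 U2 V2 U2d \/
   pwrs_typeII A1 U1 V1 U1d /\ pwrs_typeI A2 U2 V2 U2d) ->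
  0 < spectral_radius (U1d *m V1) ->
  0 < spectral_radius (U2d *m V2) ->
  V1 != 0 -> V2 != 0 ->
  mx_lt A1d A2d -> mx_le 0 A1d ->
  mx_le V1 V2 ->
  spectral_radius (U1d *m V1) < spectral_radius (U2d *m V2) /\
  spectral_radius (U2d *m V2) < 1.
Proof.
move=> mpA1 mpA2 mpU1 mpU2 types rho1 _ _ _ A12 A10 V12.
case: types => [[[ps1 _ U10 T0] [ps2 _ U20 S0]]|[[ps1 _ U10 S0] [ps2 _ U20 T0]]].
  have [E1 _] := proper_splitting_MP mpA1 mpU1 ps1.
  have [_ E2] := proper_splitting_MP mpA2 mpU2 ps2.
  rewrite (spectral_radius_mulmxC U2d).
  exact: (splitting_comparison _ _ E1 _ _ E2).
have [_ E1] := proper_splitting_MP mpA1 mpU1 ps1.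
have [E2 _] := proper_splitting_MP mpA2 mpU2 ps2.
(* Transposing exchanges the two types: [V1 U1d] becomes [U1d^T V1^T], and [U2d V2] becomes
   [V2^T U2d^T], with the radii unchanged. *)
move: rho1; rewrite (spectral_radius_mulmxC U1d) -spectral_radius_tr.
rewrite -(spectral_radius_tr (U2d *m V2)) !trmx_mul => rho1.
apply: (@splitting_comparison _ _ _ V1^T V2^T U1d^T A1d^T U2d^T A2d^T) => //;
  rewrite -?trmx_mul; try exact: mx_ge0_tr.
- by rewrite [in LHS]E1 linearD /= -mulmxA trmx_mul.
- by rewrite [in LHS]E2 linearD /= !trmx_mul mulmxA.
- by move=> i j; rewrite !mxE.
- exact: mx_le_tr.
Qed.
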